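(* Let $\alpha,\beta\in\mathbb{R}$ with $|\alpha|\neq|\beta|$. If $p,q\in\mathbb{N}$ are such that $q\ge 2p+1$, then the improper integral $$\mathcal{I}_{p,q}(\alpha,\beta)=\int_0^\infty\frac{(\cos\alpha x-\cos\beta x)^p}{x^q}\,dx$$ diverges.
   Context: $\mathbb{N}=\{1,2,3,\ldots\}$. The integral is an improper (Riemann) integral at both endpoints: it converges if $\int_\varepsilon^R$ of the integrand tends to a finite limit as $\varepsilon\to0^+$ and $R\to\infty$ independently, and it diverges otherwise. *)

(* Defs.v *)
From Stdlib Require Export Reals.
From Coquelicot Require Export Coquelicot.

Local Open Scope R_scope.

Definition integrand (p q : nat) (alpha beta x : R) : R :=
  (cos (alpha * x) - cos (beta * x)) ^ p / x ^ q.

(* [ex_RInt_gen] takes the limit along the product filter of its two endpoint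
   filters, so [eps -> 0+] and [M -> +oo] independently; as [f] is real-valued
   the limit it asserts to exist is a finite real. *)
Definition improper_converges (f : R -> R) : Prop :=
  ex_RInt_gen f (at_right 0) (Rbar_locally p_infty).

Definition improper_diverges (f : R -> R) : Prop := ~ improper_converges f.

(* Main.v *)
Require Import Defs.
From Stdlib Require Import Reals Lra Lia.
From Coquelicot Require Import Coquelicot.

Open Scope R_scope.

(** The obstruction sits at the endpoint [0].  Writing the difference of cosines
    as a product of two sines,
      [cos (a x) - cos (b x) = 2 sin ((b - a) x / 2) sin ((b + a) x / 2)],
    and using [sin t ~ t], one sees that it is of exact order [x ^ 2] and of
    constant sign on a right neighbourhood of [0], because [|a| <> |b|] makes
    [b - a] and [b + a] nonzero ([sub_cos_quadratic_lower]).  Up to a sign, the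
    integrand is then at least a positive multiple of [x ^ (2p) / x ^ q], hence
    of [1 / x] when [q >= 2p + 1] and [x <= 1]
    ([integrand_inv_lower]).  Since the integral of [1 / x] is logarithmically
    infinite at [0], convergence would violate the Cauchy criterion there
    ([improper_diverges_inv_lower]). *)

Lemma is_RInt_scal_inv (C x y : R) :
  0 < x -> x <= y -> is_RInt (fun t => C / t) x y (C * ln y - C * ln x).
Proof.
intros Hx Hxy.
apply (is_RInt_derive (fun t => C * ln t) (fun t => C / t));
  intros t; rewrite Rmin_left, Rmax_right by lra; intros Ht.
- auto_derive; [lra | field; lra].
- apply (ex_derive_continuous (fun t => C / t)).
  auto_derive; lra.
Qed.

Lemma improper_converges_scal (s : R) (f : R -> R) :
  improper_converges f -> improper_converges (fun x => s * f x).
Proof.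
intros [l Hl].
exists (scal s l).
exact (is_RInt_gen_scal f s l Hl).
Qed.

(** By Chasles, the integral over a segment inside [(0, d)] is the difference of
    two integrals sharing their right endpoint.  Convergence keeps all such
    differences below [2] near [0], but the integral of [C / x] over [[x0, x1]]
    is [C * ln (x1 / x0)], which takes the value [2] for a suitable [x0]. *)
Lemma improper_diverges_inv_lower (f : R -> R) (C d : R) :
  0 < C -> 0 < d -> (forall x, 0 < x < d -> C / x <= f x) ->
  improper_diverges f.
Proof.
intros HC Hd Hf [l Hl].
destruct (Hl (ball l (mkposreal 1 Rlt_0_1)) (locally_ball _ _))
  as [Q S [e He] [M HM] HQS].
set (x1 := Rmin d e / 2).
assert (Hx1 : 0 < x1 /\ x1 < d /\ x1 < e).
{ pose proof (cond_pos e).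
  pose proof (Rmin_l d e).
  pose proof (Rmin_r d e).
  assert (0 < Rmin d e) by (apply Rmin_glb_lt; assumption).
  unfold x1; lra. }
(* The point at which [C * ln x1 - C * ln x0 = 2]. *)
set (x0 := x1 * exp (- (2 / C))).
assert (Hexp : exp (- (2 / C)) < 1).
{ rewrite <- exp_0; apply exp_increasing.
  assert (0 < 2 / C) by (apply Rdiv_lt_0_compat; lra).
  lra. }
pose proof (exp_pos (- (2 / C))) as Hexp0.
assert (Hx0 : 0 < x0 < x1) by (unfold x0; nra).
assert (Hnear : forall x, 0 < x < e -> Q x).
{ intros x Hx; apply He; [| lra].
  change (Rabs (x - 0) < e); rewrite Rabs_pos_eq; lra. }
assert (HS : S (M + 1)) by (apply HM; lra).
destruct (HQS x0 (M + 1) (Hnear x0 ltac:(lra)) HS) as [I0 [HI0 HB0]].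
destruct (HQS x1 (M + 1) (Hnear x1 ltac:(lra)) HS) as [I1 [HI1 HB1]].
change (Rabs (I0 - l) < 1) in HB0.
change (Rabs (I1 - l) < 1) in HB1.
apply Rabs_def2 in HB0; apply Rabs_def2 in HB1.
pose proof (is_RInt_Chasles f _ _ _ _ _ HI0 (is_RInt_swap f _ _ _ HI1)) as HI.
change (is_RInt f x0 x1 (I0 + - I1)) in HI.
assert (Hle : C * ln x1 - C * ln x0 <= I0 + - I1).
{ apply (is_RInt_le (fun t => C / t) f x0 x1); [lra | | exact HI |].
  - apply is_RInt_scal_inv; lra.
  - intros x Hx; apply Hf; lra. }
assert (Hln : C * ln x1 - C * ln x0 = 2).
{ unfold x0; rewrite ln_mult, ln_exp by lra; field; lra. }
lra.
Qed.

Lemma sin_half_lower :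
  exists d, 0 < d /\ forall t, 0 < t < d -> t / 2 <= sin t.
Proof.
destruct (derivable_pt_lim_sin 0 (1 / 2) ltac:(lra)) as [d Hd].
exists d; split; [apply cond_pos |].
intros t Ht.
assert (Hlt : Rabs t < d) by (rewrite Rabs_pos_eq; lra).
specialize (Hd t ltac:(lra) Hlt).
rewrite Rplus_0_l, sin_0, cos_0, Rminus_0_r in Hd.
apply Rabs_def2 in Hd.
replace (sin t) with (sin t / t * t) by (field; lra).
nra.
Qed.

Lemma sub_cos_quadratic_lower_lt (a b : R) :
  0 <= a < b ->
  exists c d, 0 < c /\ 0 < d /\
    forall x, 0 < x < d -> c * x ^ 2 <= cos (a * x) - cos (b * x).
Proof.
intros Hab.
destruct sin_half_lower as [d [Hd Hsin]].
exists ((b - a) * (b + a) / 8), (d / (b + a)).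
split; [nra |].
split; [apply Rdiv_lt_0_compat; lra |].
intros x [Hx0 Hx].
assert (Hxd : (b + a) * x < d).
{ apply Rmult_lt_compat_l with (r := b + a) in Hx; [| lra].
  replace ((b + a) * (d / (b + a))) with d in Hx by (field; lra).
  exact Hx. }
assert (Hu : 0 < (b - a) * x) by (apply Rmult_lt_0_compat; lra).
assert (Hv : (b - a) * x <= (b + a) * x) by (apply Rmult_le_compat_r; lra).
rewrite form2.
replace ((a * x - b * x) / 2) with (- ((b - a) * x / 2)) by field.
replace ((a * x + b * x) / 2) with ((b + a) * x / 2) by field.
rewrite sin_neg.
pose proof (Hsin ((b - a) * x / 2) ltac:(lra)) as H1.
pose proof (Hsin ((b + a) * x / 2) ltac:(lra)) as H2.
assert (H12 := Rmult_le_compat ((b - a) * x / 2 / 2) _ ((b + a) * x / 2 / 2) _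
  ltac:(lra) ltac:(lra) H1 H2).
lra.
Qed.

Lemma cos_Rabs_mult (a x : R) : cos (Rabs a * x) = cos (a * x).
Proof.
unfold Rabs; destruct (Rcase_abs a); [| reflexivity].
rewrite <- cos_neg; f_equal; ring.
Qed.

(** The cosine is even, so only [|a|] and [|b|] matter; which of them is larger
    decides the sign [s]. *)
Lemma sub_cos_quadratic_lower (a b : R) :
  Rabs a <> Rabs b ->
  exists s c d, 0 < c /\ 0 < d /\
    forall x, 0 < x < d -> c * x ^ 2 <= s * (cos (a * x) - cos (b * x)).
Proof.
intros Hab.
pose proof (Rabs_pos a); pose proof (Rabs_pos b).
destruct (Rlt_or_le (Rabs a) (Rabs b)) as [Hlt | Hle].
- destruct (sub_cos_quadratic_lower_lt (Rabs a) (Rabs b)) as [c [d [Hc [Hd Hx]]]];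
    [lra |].
  exists 1, c, d; repeat split; try assumption.
  intros x H1; specialize (Hx x H1).
  rewrite !cos_Rabs_mult in Hx; lra.
- destruct (sub_cos_quadratic_lower_lt (Rabs b) (Rabs a)) as [c [d [Hc [Hd Hx]]]];
    [lra |].
  exists (-1), c, d; repeat split; try assumption.
  intros x H1; specialize (Hx x H1).
  rewrite !cos_Rabs_mult in Hx; lra.
Qed.

(** Raising the quadratic bound to the power [p] and dividing by [x ^ q] leaves
    [c ^ p * x ^ (2p - q)], and [x ^ (2p - q) >= 1 / x] for [0 < x <= 1]. *)
Lemma integrand_inv_lower (p q : nat) (a b s c x : R) :
  (2 * p + 1 <= q)%nat -> 0 < c -> 0 < x <= 1 ->
  c * x ^ 2 <= s * (cos (a * x) - cos (b * x)) ->
  c ^ p / x <= s ^ p * integrand p q a b x.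
Proof.
intros Hpq Hc Hx H.
unfold integrand.
replace (s ^ p * ((cos (a * x) - cos (b * x)) ^ p / x ^ q))
  with ((s * (cos (a * x) - cos (b * x))) ^ p / x ^ q)
  by (rewrite Rpow_mult_distr; unfold Rdiv; ring).
assert (Hpos : forall n, 0 < x ^ n) by (intros n; apply pow_lt; lra).
apply Rle_trans with ((c * x ^ 2) ^ p / x ^ q).
- rewrite Rpow_mult_distr.
  replace q with (2 * p + 1 + (q - (2 * p + 1)))%nat by lia.
  set (k := (q - (2 * p + 1))%nat).
  rewrite !pow_add, pow_1, pow_mult.
  pose proof (Hpos k) as Hk.
  assert (Hk1 : x ^ k <= 1) by (rewrite <- (pow1 k); apply pow_incr; lra).
  assert (H2 : 0 < (x ^ 2) ^ p) by (rewrite <- pow_mult; apply Hpos).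
  replace (c ^ p * (x ^ 2) ^ p / ((x ^ 2) ^ p * x * x ^ k))
    with (c ^ p / x * / x ^ k) by (field; lra).
  rewrite <- (Rmult_1_r (c ^ p / x)) at 1.
  apply Rmult_le_compat_l.
  + apply Rlt_le, Rdiv_lt_0_compat; [apply pow_lt |]; lra.
  + rewrite <- Rinv_1; apply Rinv_le_contravar; assumption.
- apply Rmult_le_compat_r; [apply Rlt_le, Rinv_0_lt_compat, Hpos |].
  apply pow_incr; split; [| exact H].
  pose proof (Hpos 2%nat); nra.
Qed.

Theorem theorem3p9 (alpha beta : R) (hab : Rabs alpha <> Rabs beta)
  (p q : nat) (hp : (1 <= p)%nat) (hq : (1 <= q)%nat)
  (hpq : (2 * p + 1 <= q)%nat) :
  improper_diverges (integrand p q alpha beta).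
Proof.
destruct (sub_cos_quadratic_lower alpha beta hab) as [s [c [d [Hc [Hd Hx]]]]].
intros Hconv.
apply (improper_converges_scal (s ^ p)) in Hconv.
revert Hconv.
apply (improper_diverges_inv_lower _ (c ^ p) (Rmin d 1)).
- apply pow_lt; exact Hc.
- apply Rmin_glb_lt; lra.
- intros x H.
  pose proof (Rmin_l d 1); pose proof (Rmin_r d 1).
  apply (integrand_inv_lower _ _ _ _ _ c); try assumption; [lra |].
  apply Hx; lra.
Qed.
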